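(* Let $X$ be a real or complex Banach space, let $Y$ be a closed subspace of $X$ having property-$(SU)$ in $X$, and let $y\in S(Y)$. Then $S_y$ is weakly compact in $X^*$ if and only if $S^{Y^*}_y$ is weakly compact in $Y^*$.
   Context: For a Banach space $E$, $S(E)$ denotes its unit sphere. For a closed subspace $Y$ of $X$, put $Y^{\#}=\{x^*\in X^*:\|x^*\|=\|x^*|_Y\|\}$, where $\|x^*|_Y\|=\sup_{y\in S(Y)}|x^*(y)|$. $Y$ has property-$(SU)$ in $X$ if $Y^{\#}$ is linear (a linear subspace of $X^*$). For $y\in S(Y)$: $S_y=\{x^*\in S(X^* ):x^*(y)=1\}$ and $S^{Y^*}_y=\{y^*\in S(Y^* ):y^*(y)=1\}$. Weakly compact in $E^*$ means compact in the weak topology $\sigma(E^*,E^{**})$. *)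

(* Defs.v *)
From HB Require Import structures.
From mathcomp Require Import all_boot all_order all_algebra complex.
From mathcomp Require Import all_classical all_reals all_analysis.
From mathcomp Require Import ring.

Set Implicit Arguments.
Unset Strict Implicit.
Unset Printing Implicit Defensive.

Import Order.TTheory GRing.Theory Num.Theory.
Import numFieldNormedType.Exports.

Local Open Scope classical_set_scope.
Local Open Scope ring_scope.

Variant scalar_kind := RealScalars | ComplexScalars.

Definition scalars (R : realType) (k : scalar_kind) : numFieldType :=
  match k with
  | RealScalars => R
  | ComplexScalars => R[i]
  end.

(* As usual in MathComp, the norm of a normedModType over K is K-valued. In the
   complex case the values are nonnegative reals of R[i], whose partial order
   only compares elements with the same imaginary part, so the supremum below is
   taken in the reals. When E = {0} the sphere is empty and the value is 0. *)
Definition sphere_norm (K : numFieldType) (E : normedModType K) (f : E -> K) : K :=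
  supremum 0 [set `|f x| | x in [set x : E | `|x| = 1]].

Section supremum_scalars.
Context (R : realType) (k : scalar_kind).
Local Notation K := (scalars R k).

Lemma supremum_scalars (A : set K) (M : K) :
  (forall a, A a -> 0 <= a) -> (forall a, A a -> a <= M) -> A !=set0 ->
  (forall a, A a -> a <= supremum 0 A) /\
  (forall u, (forall a, A a -> a <= u) -> supremum 0 A <= u).
Proof.
move=> A0 AM An.
suff [s [As sA]] : supremums A !=set0.
  have -> : supremum 0 A = s.
    rewrite /supremum; case: ifPn => [/eqP A00|_].
      by case: An => a; rewrite A00.
    case: xgetP => [x _ Ax|/(_ s) []//].
    exact: (is_subset1_supremums Ax (conj As sA)).
  by split => [a Aa|u uA]; [exact: As|exact: sA].
move: A M A0 AM An; case: k => /= A M A0 AM An.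
  have hA : has_sup A by split => //; exists M => a; exact: AM.
  exists (sup A); split; first exact: sup_upper_bound.
  by move=> u; exact: ge_sup.
pose B : set R := [set complex.Re a | a in A].
have AE a : A a -> a = (complex.Re a)%:C%C.
  by move=> /A0; rewrite lecE => /andP[/eqP]; case: a => x y /= ->.
have hB : has_sup B.
  split; first by case: An => a Aa; exists (complex.Re a); exists a.
  by exists (complex.Re M) => _ [a /AM + <-]; rewrite lecE => /andP[].
exists ((sup B)%:C%C); split => [a Aa|u uA].
  rewrite (AE a Aa) lecR; apply: sup_upper_bound => //; by exists a.
have [a Aa] := An; have := uA a Aa; rewrite (AE a Aa) lecE /= => /andP[/eqP u0 _].
rewrite lecE /= u0 eqxx /=; apply: ge_sup; first by case: hB.
by move=> _ [b /uA + <-]; rewrite lecE => /andP[].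
Qed.

End supremum_scalars.

Section dual.
Context (R : realType) (k : scalar_kind).
Local Notation K := (scalars R k).
Context (E : normedModType K).

Definition cont_linear : {pred E -> K^o} :=
  mem [set f : E -> K^o | linear f /\ continuous f].

Lemma cont_linear_submod_closed : submod_closed cont_linear.
Proof.
split=> [|a f g].
  rewrite inE; split=> [b u v|]; last exact: cst_continuous.
  by rewrite /GRing.zero /= scaler0 addr0.
rewrite !inE => -[lf cf] [lg cg]; split=> [b u v|x].
  change (a * f (b *: u + v) + g (b *: u + v) =
    b * (a * f u + g u) + (a * f v + g v) :> K).
  have -> : f (b *: u + v) = b * f u + f v :> K by exact: lf.
  have -> : g (b *: u + v) = b * g u + g v :> K by exact: lg.
  by ring.
by apply: cvgD; [apply: cvgZr; exact: cf|exact: cg].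
Qed.

HB.instance Definition _ := GRing.isSubmodClosed.Build _ _ cont_linear
  cont_linear_submod_closed.

Record dual : Type := Dual {
  dual_fun :> E -> K^o ;
  dual_funP : dual_fun \in cont_linear }.

HB.instance Definition _ := [isSub for dual_fun].
HB.instance Definition _ := [Choice of dual by <:].
HB.instance Definition _ := [SubChoice_isSubLmodule of dual by <:].

Lemma dual_linear (f : dual) : linear f.
Proof. by have := dual_funP f; rewrite inE => -[]. Qed.

Lemma dual_continuous (f : dual) : continuous f.
Proof. by have := dual_funP f; rewrite inE => -[]. Qed.

HB.instance Definition _ (f : dual) :=
  GRing.isLinear.Build K E K^o *:%R f (@dual_linear f).

Lemma dual_sphere_bounded (f : dual) :
  exists M : K, forall x : E, `|x| = 1 -> `|f x| <= M.
Proof.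
have /linear_boundedP : bounded_near f (nbhs (0 : E)).
  exact/(linear_bounded_continuous f)/dual_continuous.
move=> /pinfty_ex_gt0[M _ fM]; exists M => x x1.
by rewrite (le_trans (fM x))// x1 mulr1.
Qed.

Lemma sphere_norm_ge0 (f : E -> K) : 0 <= sphere_norm f.
Proof.
rewrite /sphere_norm /supremum; case: ifPn => // /set0P[a Aa].
case: xgetP => // x _ [Ax _]; apply: le_trans (Ax _ Aa).
by case: Aa => y _ <-.
Qed.

Lemma ler_sphere_norm (f : dual) (x : E) : `|f x| <= sphere_norm f * `|x|.
Proof.
have [->|x0] := eqVneq x 0; first by rewrite linear0 !normr0 mulr0.
have x'0 : `|x| != 0 by rewrite normr_eq0.
have y1 : `| `|x|^-1 *: x | = 1.
  by rewrite normrZ normfV normr_id mulVf.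
have [M fM] := dual_sphere_bounded f.
have [|||ub _] := @supremum_scalars R k [set `|f x| | x in [set x : E | `|x| = 1]] M.
- by move=> _ [z _ <-].
- by move=> _ [z z1 <-]; exact: fM.
- by exists `|f (`|x|^-1 *: x)|; exists (`|x|^-1 *: x).
have : `|f (`|x|^-1 *: x)| <= sphere_norm f.
  by apply: ub; exists (`|x|^-1 *: x).
rewrite linearZ /= normrZ normfV normr_id mulrC ler_pdivrMr//.
by rewrite normr_gt0.
Qed.

Lemma sphere_norm_le (f : dual) (u : K) : 0 <= u ->
  (forall x : E, `|x| = 1 -> `|f x| <= u) -> sphere_norm f <= u.
Proof.
move=> u0 fu.
have [A0|/set0P A0] := eqVneq [set `|f x| | x in [set x : E | `|x| = 1]] set0.
  by rewrite /sphere_norm A0 supremum0.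
have [|||_ lub] := @supremum_scalars R k [set `|f x| | x in [set x : E | `|x| = 1]] u.
- by move=> _ [z _ <-].
- by move=> _ [z z1 <-]; exact: fu.
- exact: A0.
- by apply: lub => _ [z z1 <-]; exact: fu.
Qed.

Lemma dual_ler_normD (f g : dual) :
  sphere_norm (f + g) <= sphere_norm f + sphere_norm g.
Proof.
apply: sphere_norm_le => [|x x1]; first by rewrite addr_ge0 ?sphere_norm_ge0.
apply: le_trans (ler_normD _ _) _; rewrite lerD//.
  by have := ler_sphere_norm f x; rewrite x1 mulr1.
by have := ler_sphere_norm g x; rewrite x1 mulr1.
Qed.

Lemma dual_normrZ (l : K) (f : dual) : sphere_norm (l *: f) = `|l| * sphere_norm f.
Proof.
have H (c : K) (g : dual) : sphere_norm (c *: g) <= `|c| * sphere_norm g.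
  apply: sphere_norm_le => [|x x1]; first by rewrite mulr_ge0 ?sphere_norm_ge0.
  have -> : (c *: g) x = c * g x by [].
  rewrite normrM ler_wpM2l//.
  by have := ler_sphere_norm g x; rewrite x1 mulr1.
apply/eqP; rewrite eq_le H /=.
have [->|l0] := eqVneq l 0; first by rewrite normr0 mul0r sphere_norm_ge0.
have := H l^-1 (l *: f); rewrite scalerA mulVf// scale1r normfV mulrC.
by rewrite ler_pdivlMr ?normr_gt0// mulrC.
Qed.

Lemma dual_normr0_eq0 (f : dual) : sphere_norm f = 0 -> f = 0.
Proof.
move=> f0; apply/val_inj/funext => x; apply/eqP; rewrite -normr_le0.
by have := ler_sphere_norm f x; rewrite f0 mul0r.
Qed.

HB.instance Definition _ := @Lmodule_isNormed.Build K dual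
  (fun f => sphere_norm f) dual_ler_normD dual_normrZ dual_normr0_eq0.

End dual.

Section weak_topology.
Context (R : realType) (k : scalar_kind) (E : normedModType (scalars R k)).

(* An alias of E carrying the coarsest topology for which every element of
   dual E is continuous. *)
Definition weak : Type := E.

HB.instance Definition _ := Choice.on weak.
HB.instance Definition _ := Topological.copy weak
  (sup_topology (fun f : dual E => Topological.on (initial_topology f))).

Definition weakly_compact (A : set E) := compact (A : set weak).

End weak_topology.

Section subspace_normed.
Context (K : numFieldType) (X : normedModType K) (Y : submodClosed X).

Record subspace_of : Type := SubspaceOf {
  subspace_val :> X ;
  subspace_valP : subspace_val \in Y }.

HB.instance Definition _ := [isSub for subspace_val].
HB.instance Definition _ := [Choice of subspace_of by <:].
HB.instance Definition _ := [SubChoice_isSubLmodule of subspace_of by <:].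

Let normY (y : subspace_of) : K := `|subspace_val y|.

Let normY_D (x y : subspace_of) : normY (x + y) <= normY x + normY y.
Proof. exact: ler_normD. Qed.

Let normY_Z (l : K) (x : subspace_of) : normY (l *: x) = `|l| * normY x.
Proof. exact: normrZ. Qed.

Let normY_eq0 (x : subspace_of) : normY x = 0 -> x = 0.
Proof. by move=> /normr0_eq0 x0; exact/val_inj. Qed.

HB.instance Definition _ := @Lmodule_isNormed.Build K subspace_of
  normY normY_D normY_Z normY_eq0.

End subspace_normed.

Section property_SU.
Context (R : realType) (k : scalar_kind) (X : normedModType (scalars R k)).

(* The set denoted Y^# in the literature: functionals on X whose norm is equal
   to the norm of their restriction to Y. *)
Definition norm_preserving (Y : submodClosed X) : set (dual X) :=
  [set f : dual X | `|f| = sphere_norm (fun y : subspace_of Y => f y)].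

Definition property_SU (Y : submodClosed X) :=
  submod_closed (mem (norm_preserving Y)).

Definition norming_face (x : X) : set (dual X) :=
  [set f : dual X | `|f| = 1 /\ f x = 1].

End property_SU.

(* Main.v *)
(* By Hahn-Banach every functional on Y has a norm-preserving extension to X, so
   under property-(SU) restriction is a linear isometry of Y^# onto Y^*. A
   functional norming y in S(Y) has norm 1 already on Y, hence S_y lies in Y^#
   and restriction maps it bijectively onto the corresponding face of Y^*.
   Restriction X^* -> Y^* and its inverse Y^* -> Y^# < X^* are both bounded and
   linear, hence weak-to-weak continuous, and they carry weak compactness of one
   face to the other. *)
Require Import Defs.
From HB Require Import structures.
From mathcomp Require Import all_boot all_order all_algebra complex.
From mathcomp Require Import all_classical all_reals all_analysis.
From mathcomp Require Import ring lra.

Set Implicit Arguments.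
Unset Strict Implicit.
Unset Printing Implicit Defensive.

Import Order.TTheory GRing.Theory Num.Theory.
Import numFieldNormedType.Exports.

Local Open Scope classical_set_scope.
Local Open Scope ring_scope.

(** * Hahn-Banach under a sublinear bound *)

Section hahn_banach.
Context (R : realType) (V : lmodType R) (p : V -> R).
Hypothesis p_subadd : forall u v, p (u + v) <= p u + p v.
Hypothesis p_homo : forall a u, 0 <= a -> p (a *: u) = a * p u.

(** Partial functionals are encoded by their graphs, so that extension is inclusion and Zorn's lemma
    applies to unions of chains. *)
Definition dominated_graph (G : set (V * R)) :=
  (forall a u r v s, G (u, r) -> G (v, s) -> G (a *: u + v, a * r + s)) /\
  (forall u r, G (u, r) -> r <= p u).

(** Subtracting two pairs over [u] gives a pair over [0], where the bound is [p 0 = 0]. *)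
Lemma dominated_graph_uniq G u r s :
  dominated_graph G -> G (u, r) -> G (u, s) -> r = s.
Proof.
move=> [Gl Gp] Gr Gs.
have p0 : p 0 = 0 by rewrite -(scale0r 0) p_homo// mul0r.
have H a b : G (u, a) -> G (u, b) -> b <= a.
  move=> Ga Gb; have := Gp _ _ (Gl (-1) _ _ _ _ Ga Gb).
  by rewrite scaleN1r addNr p0; lra.
by apply/eqP; rewrite eq_le !H.
Qed.

(** The value [c] at [v] must satisfy [s - p (w' - v) <= c <= p (w + v) - r] for all points
    [(w', s)] and [(w, r)] of [G]. Subadditivity puts every left side below every right side, so the
    supremum of the left sides will do. *)
Lemma dominated_graph_extend G v : dominated_graph G -> G (0, 0) ->
  exists c, dominated_graph
    [set z | exists w r t, G (w, r) /\ z = (w + t *: v, r + t * c)].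
Proof.
move=> [Gl Gp] G0.
pose A : set R := [set x | exists w s, G (w, s) /\ x = s - p (w - v)].
have GZ a w r : G (w, r) -> G (a *: w, a * r).
  by move=> Gw; have := Gl a _ _ _ _ Gw G0; rewrite !addr0.
have Aub w r : G (w, r) -> ubound A (p (w + v) - r).
  move=> Gw _ [w' [s [Gw' ->]]].
  have := Gp _ _ (Gl 1 _ _ _ _ Gw Gw'); rewrite scale1r mul1r.
  have := p_subadd (w + v) (w' - v); rewrite addrACA subrr addr0; lra.
have hA : has_sup A.
  split; first by exists (0 - p (0 - v)); exists 0, 0.
  by exists (p (0 + v) - 0); exact: Aub.
exists (sup A); split.
  move=> a _ _ _ _ [w [r [t [Gw [-> ->]]]]] [w' [r' [t' [Gw' [-> ->]]]]].
  exists (a *: w + w'), (a * r + r'), (a * t + t'); split; first exact: Gl.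
  congr pair; last by ring.
  by rewrite scalerDr scalerDl scalerA addrACA.
move=> _ _ [w [r [t [Gw [-> ->]]]]].
(* After division by [|t|], the case [t > 0] uses an upper bound of the supremum, and the case
   [t < 0] a lower one. *)
have [t0|t0|->] := ltgtP t 0; last first.
- by rewrite scale0r mul0r !addr0; exact: Gp.
- have tn : t != 0 by rewrite gt_eqF.
  have /(ge_sup hA.1) := Aub _ _ (GZ t^-1 _ _ Gw).
  have -> : w + t *: v = t *: (t^-1 *: w + v).
    by rewrite scalerDr scalerA divff// scale1r.
  rewrite p_homo ?(ltW t0)// -(ler_pM2l t0) mulrBr mulrA divff// mul1r; lra.
- have tn : - t != 0 by rewrite oppr_eq0 lt_eqF.
  have tp : 0 < - t by rewrite oppr_gt0.
  have : A ((- t)^-1 * r - p ((- t)^-1 *: w - v)).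
    by exists ((- t)^-1 *: w), ((- t)^-1 * r); split=> //; exact: GZ.
  move=> /(sup_upper_bound hA).
  have -> : w + t *: v = - t *: ((- t)^-1 *: w - v).
    by rewrite scalerBr scalerA divff// scale1r scaleNr opprK.
  rewrite p_homo ?(ltW tp)// -(ler_pM2l tp) mulrBr mulrA divff// mul1r; lra.
Qed.

(** A maximal dominated graph containing that of [g] on [W] is total, since a missing point could be
    adjoined. *)
Theorem hahn_banach (W : {pred V}) (g : V -> R) : submod_closed W ->
  {in W &, forall u v a, g (a *: u + v) = a * g u + g v} ->
  {in W, forall u, g u <= p u} ->
  exists f : V -> R, [/\ (forall a u v, f (a *: u + v) = a * f u + f v),
    (forall u, f u <= p u) & {in W, f =1 g}].
Proof.
move=> [W0 Wl] gl gp.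
pose Gg : set (V * R) := [set z | z.1 \in W /\ z.2 = g z.1].
have Gg0 : Gg (0, 0).
  by split=> //=; have := gl 0 0 W0 W0 (-1); rewrite scaler0 addr0; lra.
have dGg : dominated_graph Gg.
  split=> [a u r v s [/= uW ->] [/= vW ->]|u r [/= uW ->]]; last exact: gp.
  by split; rewrite /= ?gl// Wl.
(* The guard [G !=set0] makes the union of the empty chain admissible. *)
have [|G [[dG GgG] Gmax]] := @Zorn_bigcup _
    [set G | dominated_graph G /\ (G !=set0 -> Gg `<=` G)].
  move=> F FP Ftot; split; last first.
    move=> [z [G FG Gz]] x Ggx; exists G => //.
    by apply: (FP _ FG).2 => //; exists z.
  split=> [a u r v s [G FG Gu] [H FH Hv]|u r [G FG]]; last exact: (FP _ FG).1.2.
  have [GH|HG] := Ftot _ _ FG FH.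
    by exists H => //; apply: (FP _ FH).1.1 => //; exact: GH.
  by exists G => //; apply: (FP _ FG).1.1 => //; exact: HG.
have {}GgG : Gg `<=` G.
  (* Were the maximal graph empty, [Gg] would properly extend it. *)
  have [G0|/set0P/GgG//] := eqVneq G set0.
  exfalso; apply: (Gmax Gg); last by split=> // _.
  by rewrite G0; split; [exact: sub0set|move=> /(_ _ Gg0)].
have G00 : G (0, 0) by exact: GgG.
have Gtot v : exists r, G (v, r).
  apply: contrapT => nv.
  have [c dB] := @dominated_graph_extend G v dG G00.
  apply: (Gmax _ _ (conj dB _)).
    split; last first.
      move=> /(_ (v, c)) BG; apply: nv; exists c; apply: BG.
      by exists 0, 0, 1; rewrite !add0r scale1r mul1r.
    by move=> [w r] Gw; exists w, r, 0; rewrite scale0r mul0r !addr0.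
  move=> _ [w r] /GgG Gw; exists w, r, 0.
  by rewrite scale0r mul0r !addr0.
have [f fG] := choice Gtot.
exists f; split=> [a u v|u|u uW].
- by apply: (dominated_graph_uniq (G := G)) => //; exact: dG.1.
- exact: dG.2.
- by apply: (dominated_graph_uniq (G := G)) => //; exact: GgG.
Qed.

End hahn_banach.

(** * Extension under a norm bound, over real and complex scalars *)

Section realification.
Context (R : realType) (V : lmodType R[i]).
Local Open Scope complex_scope.

(** An alias, so that the real scalar action does not compete with the complex one on [V]. *)
Definition realification : Type := V.

HB.instance Definition _ := GRing.Zmodule.on realification.

Definition realification_scale (a : R) (v : realification) : realification :=
  a%:C *: (v : V).

Let scaleA a b v :
  realification_scale a (realification_scale b v) =
  realification_scale (a * b) v.
Proof. by rewrite /realification_scale scalerA rmorphM. Qed.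

Let scale1 : left_id 1 realification_scale.
Proof. by move=> v; rewrite /realification_scale scale1r. Qed.

Let scaleDr : right_distributive realification_scale +%R.
Proof. by move=> a u v; rewrite /realification_scale scalerDr. Qed.

Let scaleDl v : {morph realification_scale^~ v : a b / a + b}.
Proof. by move=> a b; rewrite /realification_scale rmorphD scalerDl. Qed.

HB.instance Definition _ := GRing.Zmodule_isLmodule.Build R realification
  scaleA scale1 scaleDr scaleDl.

End realification.

(** [hahn_banach] expects a function on the whole space but reads it only on [W]; [0] is a filler
    off [Y]. *)
Definition zero_extension (K : numFieldType) (X : normedModType K)
    (Y : submodClosed X) (g : subspace_of Y -> K) (x : X) : K :=
  if insub x is Some y then g y else 0.

Lemma zero_extensionE (K : numFieldType) (X : normedModType K)
    (Y : submodClosed X) (g : subspace_of Y -> K) (y : subspace_of Y) :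
  zero_extension g (subspace_val y) = g y.
Proof. by rewrite /zero_extension (valK y). Qed.

Lemma hahn_banach_real (R : realType) (X : normedModType R) (Y : submodClosed X)
    (g : subspace_of Y -> R) (c : R) : 0 <= c ->
  (forall a u v, g (a *: u + v) = a * g u + g v) ->
  (forall y, `|g y| <= c * `|y|) ->
  exists f : X -> R, [/\ forall a u v, f (a *: u + v) = a * f u + f v,
    forall x, `|f x| <= c * `|x| & forall y, f (subspace_val y) = g y].
Proof.
move=> c0 gl gc.
have [|||||f [fl fc fg]] :=
    @hahn_banach R X (fun x => c * `|x|) _ _ Y (zero_extension g).
- by move=> u v; rewrite -mulrDr ler_wpM2l// ler_normD.
- by move=> a u a0; rewrite normrZ ger0_norm// mulrCA.
- by split; [exact: rpred0|move=> a u v uY vY; rewrite rpredD// rpredZ].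
- move=> u v uY vY a.
  pose y := SubspaceOf uY; pose z := SubspaceOf vY.
  rewrite -[u]/(subspace_val y) -[v]/(subspace_val z).
  by rewrite -[_ *: _ + _]/(subspace_val (a *: y + z)) !zero_extensionE gl.
- move=> u uY; rewrite -[u]/(subspace_val (SubspaceOf uY)) zero_extensionE.
  exact: le_trans (ler_norm _) (gc _).
exists f; split=> // [x|y]; last by rewrite fg ?zero_extensionE// subspace_valP.
(* The lower bound on [f x] is the upper bound at [- x]. *)
rewrite ler_norml fc andbT lerNl.
have -> : - f x = f (- x).
  have f0 := fl (-1) 0 0; have := fl (-1) x 0.
  by move: f0; rewrite !scaleN1r !addr0 oppr0; lra.
by rewrite -normrN fc.
Qed.

Lemma hahn_banach_complex (R : realType) (X : normedModType R[i])
    (Y : submodClosed X) (g : subspace_of Y -> R[i]) (c : R[i]) : 0 <= c ->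
  (forall a u v, g (a *: u + v) = a * g u + g v) ->
  (forall y, `|g y| <= c * `|y|) ->
  exists f : X -> R[i], [/\ forall a u v, f (a *: u + v) = a * f u + f v,
    forall x, `|f x| <= c * `|x| & forall y, f (subspace_val y) = g y].
Proof.
move=> c0 gl gc.
(* Norms take values in [R[i]], while [hahn_banach] needs a real bound. As [c * |x|] is nonnegative,
   it equals its real part. *)
pose p (x : X) := complex.Re (c * `|x|).
have pE x : (p x)%:C%C = c * `|x|.
  by apply: RRe_real; apply: ger0_real; rewrite mulr_ge0.
have [|||||h [hl hp hg]] := @hahn_banach R (realification X) p _ _
    Y (fun x => complex.Re (zero_extension g x)).
- move=> u v; rewrite -lecR rmorphD/= !pE.
  by rewrite -mulrDr ler_wpM2l// ler_normD.
- move=> a u a0; apply: complexI; rewrite rmorphM/= !pE.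
  rewrite [a *: u]/(a%:C%C *: (u : X)) normrZ ger0_norm ?ler0c//.
  by rewrite mulrCA.
- split; first exact: (rpred0 Y).
  by move=> a u v uY vY; rewrite (rpredD (S:=Y))// (rpredZ (s:=Y)).
- move=> u v uY vY a.
  pose y := SubspaceOf uY; pose z := SubspaceOf vY.
  rewrite -[u]/(subspace_val y) -[v]/(subspace_val z).
  rewrite -[_ *: _ + _]/(subspace_val (a%:C%C *: y + z)) !zero_extensionE gl.
  case: (g y) (g z) => [y1 y2] [z1 z2] /=.
  by rewrite mul0r subr0.
- move=> u uY; rewrite -[u]/(subspace_val (SubspaceOf uY)) zero_extensionE.
  rewrite -lecR pE; apply: le_trans (gc _).
  by apply: le_trans (normc_ge_Re _); rewrite lecR ler_norm.
(* [h] is the real part of the extension [f]: [Im (f x) = - Re (f (i x))]. *)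
pose f (x : X) : R[i] := Complex (h x) (- h ('i%C *: x)).
have hl' (a : R) (u v : X) : h (a%:C%C *: u + v) = a * h u + h v by exact: hl.
have hD (u v : X) : h (u + v) = h u + h v.
  by have := hl' 1 u v; rewrite scale1r mul1r.
have h0 : h (0 : X) = 0 by have := hD 0 0; rewrite addr0; lra.
have hZ (a : R) (u : X) : h (a%:C%C *: u) = a * h u.
  by have := hl' a u 0; rewrite !addr0 h0 addr0.
have fl a u v : f (a *: u + v) = a * f u + f v.
  (* [h] is only real-linear: a complex scalar acts through the values of [h] at [w] and [i w],
     which turns linearity of [f] into ring identities. *)
  have hC (b : R[i]) (w : X) :
      h (b *: w) = complex.Re b * h w + complex.Im b * h ('i%C *: w).
    rewrite {1}[b]complexE scalerDl hD hZ [_ * (_)%:C%C]mulrC -scalerA.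
    by rewrite [in LHS]hZ.
  apply/eqP; rewrite eq_complex; case: a => a b.
  rewrite /f scalerDr !hD scalerA (hC (Complex a b)) (hC ('i%C * _)) /=.
  apply/andP; split; apply/eqP; ring.
exists f; split=> // [x|y].
  have [->|fx0] := eqVneq (f x) 0; first by rewrite normr0 mulr_ge0.
  (* A unimodular [a] rotates [f x] onto the positive axis, where [f] is [h]. *)
  pose a := `|f x| / f x.
  have a1 : `|a| = 1 by rewrite normrM normr_id normfV divff// normr_eq0.
  have fax : f (a *: x) = `|f x|.
    have := fl a x 0; rewrite addr0 => ->.
    have -> : f 0 = 0 by rewrite /f scaler0 h0 oppr0.
    by rewrite addr0 divfK.
  rewrite -[`|x|]mul1r -a1 -normrZ -pE -fax.
  have -> : f (a *: x) = (h (a *: x))%:C%C.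
    have : 0 <= f (a *: x) by rewrite fax.
    by rewrite lecE => /andP[/eqP /= Im0 _]; rewrite /f Im0.
  by rewrite lecR.
have hgy z : h (subspace_val z) = complex.Re (g z).
  by rewrite hg ?zero_extensionE// subspace_valP.
rewrite /f -[_ *: _]/(subspace_val ('i%C *: y)) !hgy.
(* The second instance yields [g 0 = 0], so the first reads [g (i y) = i g y], and [- Re (i g y)] is
   the imaginary part of [g y]. *)
have := gl 'i%C y 0; have := gl 1 0 0.
rewrite scaler0 !addr0 mul1r => g0 ->.
have -> : g 0 = 0 by apply: (addrI (g 0)); rewrite addr0 -g0.
by case: (g y) => s t /=; rewrite mul0r mul1r addr0 sub0r opprK.
Qed.

Lemma hahn_banach_normed (R : realType) (k : scalar_kind)
    (X : normedModType (scalars R k)) (Y : submodClosed X)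
    (g : subspace_of Y -> scalars R k) (c : scalars R k) : 0 <= c ->
  (forall a u v, g (a *: u + v) = a * g u + g v) ->
  (forall y, `|g y| <= c * `|y|) ->
  exists f : X -> scalars R k,
    [/\ forall a u v, f (a *: u + v) = a * f u + f v,
    forall x, `|f x| <= c * `|x| & forall y, f (subspace_val y) = g y].
Proof.
case: k X Y g c => X Y g c; first exact: hahn_banach_real.
exact: hahn_banach_complex.
Qed.

(** * Bounded functionals and weak continuity *)

Section bounded_functionals.
Context (R : realType) (k : scalar_kind).
Local Notation K := (scalars R k).

Lemma bounded_cont_linear (E : normedModType K) (f : E -> K^o) (c : K) :
  0 <= c -> linear f -> (forall x, `|f x| <= c * `|x|) ->
  f \in @cont_linear R k E.
Proof.
move=> c0 fl fc; rewrite inE; split=> //.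
pose fL := GRing.isLinear.Build K E K^o *:%R f fl.
pose F : {linear E -> K^o} := HB.pack f fL.
apply: (@bounded_linear_continuous _ _ _ F).
apply/linear_boundedP; exists c; split=> [|M cM x]; first exact: ger0_real.
by apply: le_trans (fc x) _; rewrite ler_wpM2r// ltW.
Qed.

(** The reverse norm inequality holds for any extension, by [norm_dual_restriction]. *)
Lemma hahn_banach_dual (X : normedModType K) (Y : submodClosed X)
    (g : dual (subspace_of Y)) :
  exists2 f : dual X, (forall y, f (subspace_val y) = g y) & `|f| <= `|g|.
Proof.
have [|||f [fl fc fg]] := @hahn_banach_normed R k X Y g `|g|.
- exact: normr_ge0.
- by move=> a u v; rewrite linearP.
- exact: ler_sphere_norm.
exists (Dual (bounded_cont_linear (normr_ge0 g) fl fc)) => //.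
apply: sphere_norm_le; first exact: normr_ge0.
by move=> x x1; have := fc x; rewrite x1 mulr1.
Qed.

(** The weak topology of [F] is initial for [dual F], so it suffices to treat each [d \o T]. This is
    linear and bounded by [|d| * c], hence an element of [dual E], weakly continuous by
    construction. *)
Lemma bounded_linear_weak_continuous (E F : normedModType K) (T : E -> F)
    (c : K) :
  0 <= c -> linear T -> (forall x, `|T x| <= c * `|x|) ->
  continuous (T : weak E -> weak F).
Proof.
move=> c0 Tl Tc /= x.
have FF : Filter (nbhs (x : weak E)) by exact: nbhs_filter.
apply/(@cvg_sup _ _ _ (fmap T (nbhs (x : weak E)))) => d.
pose dT : E -> K^o := fun u => d (T u).
have dTl : linear dT by move=> a u v; rewrite /dT Tl linearP.
have dTc u : `|dT u| <= `|d| * c * `|u|.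
  apply: le_trans (ler_sphere_norm d _) _.
  by rewrite -mulrA; apply: ler_wpM2l => //; exact: (normr_ge0 d).
pose e := Dual (bounded_cont_linear (mulr_ge0 (normr_ge0 d) c0) dTl dTc).
have xe : nbhs (x : weak E) --> (x : initial_topology e).
  move: e; apply: (@cvg_sup E _
    (fun f : dual E => Topological.on (initial_topology f)) _ x FF).1.
  by [].
(* A basic neighbourhood of [T x] for [d] is the [d]-preimage of an open [W]; its preimage under [T]
   is the [e]-preimage of [W]. *)
move=> U [V [[W oW <-] /= Wx VU]].
apply: xe; exists (e @^-1` W); split=> //; first by exists W.
by move=> u /VU.
Qed.

End bounded_functionals.

(** * Restriction to [Y] under property-(SU) *)

Section restriction.
Context (R : realType) (k : scalar_kind) (X : normedModType (scalars R k)).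
Context (Y : submodClosed X).

Lemma dual_restriction_subproof (f : dual X) :
  (fun y : subspace_of Y => f (subspace_val y))
    \in @cont_linear R k (subspace_of Y).
Proof.
apply: (@bounded_cont_linear _ _ _ _ `|f|) => // [a u v|y].
  by rewrite -linearP.
exact: ler_sphere_norm.
Qed.

Definition dual_restriction (f : dual X) : dual (subspace_of Y) :=
  Dual (dual_restriction_subproof f).

Lemma dual_restriction_linear : linear dual_restriction.
Proof. by move=> a f g; exact/val_inj. Qed.

Lemma norm_dual_restriction (f : dual X) : `|dual_restriction f| <= `|f|.
Proof.
apply: sphere_norm_le => // y y1.
have := ler_sphere_norm f (subspace_val y).
by rewrite [`|subspace_val y|]y1 mulr1.
Qed.

Lemma norm_preservingE (f : dual X) :
  norm_preserving Y f = (`|f| = `|dual_restriction f|).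
Proof. by []. Qed.

Hypothesis Y_SU : property_SU Y.

(** By linearity of [norm_preserving Y], the norm of [f - g] is that of its restriction, which is
    zero. *)
Lemma norm_preserving_inj (f g : dual X) :
  norm_preserving Y f -> norm_preserving Y g ->
  dual_restriction f = dual_restriction g -> f = g.
Proof.
move=> fY gY fg; apply/eqP; rewrite -subr_eq0 -normr_eq0.
have : norm_preserving Y (-1 *: g + f).
  by have := Y_SU.2 (-1) g f; rewrite !inE; apply.
rewrite norm_preservingE dual_restriction_linear fg !scaleN1r addNr normr0.
by rewrite addrC => ->.
Qed.

(** Hahn-Banach and choice provide [e]. It is linear by uniqueness: [e (a *: g + h)] and
    [a *: e g + e h] are both norm-preserving, the latter by property-(SU), and have the same
    restriction. *)
Lemma norm_preserving_extension : exists e : dual (subspace_of Y) -> dual X,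
  [/\ linear e, (forall g, norm_preserving Y (e g)) &
    cancel e dual_restriction].
Proof.
have ex (g : dual (subspace_of Y)) :
    exists f, norm_preserving Y f /\ dual_restriction f = g.
  have [f fg lefg] := hahn_banach_dual g; exists f.
  have rf : dual_restriction f = g by apply/val_inj/funext.
  split=> //; rewrite norm_preservingE; apply/eqP.
  by rewrite eq_le norm_dual_restriction andbT rf.
have [e eP] := choice ex; exists e; split=> [a g h|g|g].
- apply: norm_preserving_inj.
  + exact: (eP _).1.
  + have := Y_SU.2 a (e g) (e h); rewrite !inE; apply; exact: (eP _).1.
  + by rewrite dual_restriction_linear !(eP _).2.
- exact: (eP _).1.
- exact: (eP _).2.
Qed.

(** The restriction has norm at most [|f| = 1], and at least [|f y| = 1] because [y] is a unit
    vector of [Y]. *)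
Lemma norming_face_preserving (y : subspace_of Y) (f : dual X) : `|y| = 1 ->
  norming_face (subspace_val y) f ->
  norm_preserving Y f /\ norming_face y (dual_restriction f).
Proof.
move=> y1 [f1 fy]; suff r1 : `|dual_restriction f| = 1.
  by split; [rewrite norm_preservingE r1|split].
apply/eqP; rewrite eq_le -{1}f1 norm_dual_restriction /=.
have := ler_sphere_norm (dual_restriction f) y.
by rewrite [dual_restriction f y]fy normr1 y1 mulr1.
Qed.

End restriction.

Theorem theorem3p2 (R : realType) (k : scalar_kind)
    (X : completeNormedModType (scalars R k)) (Y : submodClosed X)
    (Y_closed : closed [set x : X | x \in Y]) (Y_SU : property_SU Y)
    (y : subspace_of Y) (y_sphere : `|y| = 1) :
  weakly_compact (norming_face (subspace_val y)) <->
  weakly_compact (norming_face y).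
Proof.
have [e [el eY eK]] := norm_preserving_extension Y_SU.
have e_norm g : `|e g| = `|g| by have := eY g; rewrite norm_preservingE eK.
have face_restr : norming_face y =
    dual_restriction Y @` norming_face (subspace_val y).
  apply/seteqP; split=> [g [g1 gy]|_ [f /norming_face_preserving[]// _ ? <-//]].
  exists (e g) => //; split; first by rewrite e_norm.
  exact: etrans (congr1 (fun h : dual _ => h y) (eK g)) gy.
(* On the face in [dual X], [e] undoes restriction: [f] and [e] of its restriction are
   norm-preserving extensions of one functional. *)
have face_ext : norming_face (subspace_val y) = e @` norming_face y.
  rewrite face_restr; apply/seteqP; split=> [f fy|_ [_ [f fy <-] <-]].
    exists (dual_restriction Y f); first by exists f.
    apply: (norm_preserving_inj Y_SU) => //.
    exact: (norming_face_preserving y_sphere fy).1.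
  suff -> : e (dual_restriction Y f) = f by [].
  apply: (norm_preserving_inj Y_SU) => //.
  exact: (norming_face_preserving y_sphere fy).1.
split=> [cX|cY].
  rewrite /weakly_compact face_restr.
  apply: (@continuous_compact (weak (dual X))
    (weak (dual (subspace_of Y)))) => //.
  apply: continuous_subspaceT.
  apply: (bounded_linear_weak_continuous ler01
    (@dual_restriction_linear _ _ _ _)).
  by move=> f; rewrite mul1r norm_dual_restriction.
rewrite /weakly_compact face_ext.
apply: (@continuous_compact (weak (dual (subspace_of Y)))
  (weak (dual X))) => //.
apply: continuous_subspaceT.
apply: (bounded_linear_weak_continuous ler01 el).
by move=> g; rewrite mul1r e_norm.
Qed.
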